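(* For any finite simple graph $G$, $$\ell(\mathcal A(G))\ \ge\ \mathrm{def}(G).$$
   Context: Fix an orientation of the edges of $G=(V,E)$; the oriented incidence matrix $D$ is the $|V|\times|E|$ matrix with $D_{ve}=+1$ if $v$ is the head of $e$, $-1$ if $v$ is the tail of $e$, and $0$ otherwise. The antisymmetric line graph $\mathcal A(G)$ is the signed graph with vertex set $E(G)$ and signed adjacency matrix $D^{\mathsf T}D-2I$ (nonzero entries are edges, with the entry $\pm1$ as sign). Switching a signed graph at a vertex reverses the signs of all edges incident to it; changing the orientation changes $\mathcal A(G)$ only by switching. The sign of a cycle is the product of its edge signs, and a signed graph is balanced if all its cycles are positive. The frustration index $\ell(\Sigma)$ of a signed graph $\Sigma$ is the minimum number of edges whose deletion makes $\Sigma$ balanced (equivalently, the minimum number of negative edges among all switchings of $\Sigma$); it is switching invariant. The Max-Cut defect is $\mathrm{def}(G)=|E(G)|-\mathrm{MaxCut}(G)$, where $\mathrm{MaxCut}(G)$ is the maximum number of edges between the two sides of a bipartition of $V(G)$; equivalently it is the minimum number of edges whose removal makes $G$ bipartite. *)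

(* Defs.v *)
From HB Require Import structures.
From mathcomp Require Import all_boot all_order all_algebra.
Set Implicit Arguments.
Unset Strict Implicit.
Unset Printing Implicit Defensive.
Import Order.TTheory GRing.Theory Num.Theory.
Local Open Scope ring_scope.

Record simple_graph (V : finType) := SimpleGraph {
  adj : rel V;
  adj_sym : symmetric adj;
  adj_irr : irreflexive adj
}.

Definition edges (V : finType) (G : simple_graph V) : {set {set V}} :=
  [set [set p.1; p.2] | p : V * V & adj G p.1 p.2].

Definition edge (V : finType) (G : simple_graph V) : finType :=
  {f : {set V} | f \in edges G}.

Record orientation (V : finType) (G : simple_graph V) := Orientation {
  tail : edge G -> V;
  head : edge G -> V;
  orientationP : forall f : edge G, val f = [set tail f; head f]
}.

(* Rows and columns are numbered by the canonical enumerations of the vertices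
   and of the edges. *)
Definition incidence (V : finType) (G : simple_graph V) (o : orientation G) :
    'M[int]_(#|V|, #|edge G|) :=
  \matrix_(i, j)
    (if enum_val i == head o (enum_val j) then 1
     else if enum_val i == tail o (enum_val j) then -1
     else 0).

(* A signed graph is given by its signed adjacency matrix: a nonzero entry is
   an edge, and its value is the sign of that edge. *)
Record signed_graph (T : finType) := SignedGraph {
  sadj : T -> T -> int;
  sadj_sym : forall x y, sadj x y = sadj y x;
  sadj_diag : forall x, sadj x x = 0;
  sadj_val : forall x y, sadj x y \in [:: -1; 0; 1]
}.

Definition signed_edges (T : finType) (S : signed_graph T) : {set {set T}} :=
  [set [set p.1; p.2] | p : T * T & sadj S p.1 p.2 != 0].

Definition delete_adj (T : finType) (S : signed_graph T) (F : {set {set T}})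
    (x y : T) : int :=
  if [set x; y] \in F then 0 else sadj S x y.

Lemma delete_adj_sym (T : finType) (S : signed_graph T) F x y :
  delete_adj S F x y = delete_adj S F y x.
Proof. by rewrite /delete_adj setUC sadj_sym. Qed.

Lemma delete_adj_diag (T : finType) (S : signed_graph T) F x :
  delete_adj S F x x = 0.
Proof. by rewrite /delete_adj sadj_diag if_same. Qed.

Lemma delete_adj_val (T : finType) (S : signed_graph T) F x y :
  delete_adj S F x y \in [:: -1; 0; 1].
Proof. by rewrite /delete_adj; case: ifP => // _; apply: sadj_val. Qed.

Definition delete_edges (T : finType) (S : signed_graph T)
    (F : {set {set T}}) : signed_graph T :=
  SignedGraph (@delete_adj_sym T S F) (@delete_adj_diag T S F)
              (@delete_adj_val T S F).

(* A cycle is listed without repeating its starting vertex. *)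
Definition is_cycle (T : finType) (S : signed_graph T) (p : seq T) : bool :=
  [&& (2 < size p)%N, uniq p & cycle [rel x y | sadj S x y != 0] p].

Definition cycle_sign (T : finType) (S : signed_graph T) (p : seq T) : int :=
  \prod_(x <- p) sadj S x (next p x).

(* The bound on the length makes this decidable; it loses nothing since a cycle
   has no repeated vertex, see [balancedP]. *)
Definition balanced (T : finType) (S : signed_graph T) : bool :=
  [forall n : 'I_#|T|.+1, [forall p : n.-tuple T,
     is_cycle S p ==> (cycle_sign S p == 1)]].

Lemma balancedP (T : finType) (S : signed_graph T) :
  reflect (forall p : seq T, is_cycle S p -> cycle_sign S p = 1) (balanced S).
Proof.
apply: (iffP forallP) => [bS p cp | bS n].
  have /and3P[_ /card_uniqP sz _] := cp.
  have lt_p : (size p < #|T|.+1)%N by rewrite ltnS -sz max_card.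
  by have /forallP/(_ (in_tuple p))/implyP/(_ cp)/eqP := bS (Ordinal lt_p).
by apply/forallP => p; apply/implyP => /bS ->.
Qed.

Lemma balanced_delete_all (T : finType) (S : signed_graph T) :
  balanced (delete_edges S (signed_edges S)).
Proof.
apply/balancedP => -[|x [|y p]] /and3P[] //= _ _ /andP[].
rewrite /delete_adj; case: ifP => [|/negP xyF nz]; first by rewrite eqxx.
by case: xyF; apply/imsetP; exists (x, y) => //; rewrite inE.
Qed.

Lemma frustration_proof (T : finType) (S : signed_graph T) :
  exists n, [exists F : {set {set T}},
    [&& F \subset signed_edges S, balanced (delete_edges S F) & #|F| == n]].
Proof.
exists #|signed_edges S|; apply/existsP; exists (signed_edges S).
by rewrite subxx balanced_delete_all eqxx.
Qed.

Definition frustration (T : finType) (S : signed_graph T) : nat :=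
  ex_minn (frustration_proof S).

Definition cut_edges (V : finType) (G : simple_graph V) (A : {set V}) :
    {set {set V}} :=
  [set f in edges G | (f :&: A != set0) && (f :&: ~: A != set0)].

Definition maxcut (V : finType) (G : simple_graph V) : nat :=
  (\max_(A : {set V}) #|cut_edges G A|)%N.

(* The subtraction never truncates, by [leq_maxcut]. *)
Definition maxcut_defect (V : finType) (G : simple_graph V) : nat :=
  (#|edges G| - maxcut G)%N.

Lemma leq_maxcut (V : finType) (G : simple_graph V) :
  (maxcut G <= #|edges G|)%N.
Proof.
apply/bigmax_leqP => A _; apply: subset_leq_card.
by apply/subsetP => f; rewrite inE => /andP[].
Qed.

Section AntisymmetricLineGraph.
Variables (V : finType) (G : simple_graph V) (o : orientation G).

Definition line_adj (f g : edge G) : int :=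
  ((incidence o)^T *m incidence o - 2%:M) (enum_rank f) (enum_rank g).

Lemma tail_neq_head f : tail o f != head o f.
Proof.
have /imsetP[[x y] /= xy Ef] := valP f; rewrite inE /= in xy.
have neq_xy : x != y by apply: contraTneq xy => ->; rewrite adj_irr.
apply/negP => /eqP th; have := cards2 x y.
by rewrite -Ef (orientationP o) th setUid cards1 neq_xy.
Qed.

Let D (v : V) (f : edge G) : int := (v == head o f)%:R - (v == tail o f)%:R.

Lemma line_adjE f g :
  line_adj f g = D (head o f) g - D (tail o f) g - (f == g)%:R *+ 2.
Proof.
have DE v h : (if v == head o h then 1 else if v == tail o h then -1 else 0)
              = D v h.
  rewrite /D; case: eqP => [->|_].
    by rewrite eq_sym (negPf (tail_neq_head h)) subr0.
  by case: eqP; rewrite ?sub0r ?subr0.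
rewrite /line_adj !mxE (inj_eq enum_rank_inj) mulrb.
congr (_ - _); last by case: eqP.
transitivity (\sum_(v : V) D v f * D v g).
  rewrite (reindex (@enum_val _ (mem V))) /=; last first.
    by apply: onW_bij; apply: enum_val_bij.
  by apply: eq_bigr => i _; rewrite !mxE !enum_rankK !DE.
rewrite (eq_bigr (fun v => (v == head o f)%:R * D v g
                         - (v == tail o f)%:R * D v g)); last first.
  by move=> v _; rewrite {1}/D mulrBl.
have pick w : \sum_v (v == w)%:R * D v g = D w g.
  rewrite (bigD1 w) //= eqxx mul1r big1 ?addr0 // => v /negPf ->.
  by rewrite mul0r.
by rewrite sumrB !pick.
Qed.

Lemma line_adj_sym f g : line_adj f g = line_adj g f.
Proof.
rewrite /line_adj; set M := _ - _.
have MT : M^T = M by rewrite linearB /= trmx_mul trmxK tr_scalar_mx.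
by rewrite -{1}MT mxE.
Qed.

Lemma line_adj_diag f : line_adj f f = 0.
Proof.
rewrite line_adjE /D !eqxx (negPf (tail_neq_head f)).
by rewrite eq_sym (negPf (tail_neq_head f)).
Qed.

Lemma line_adj_val f g : line_adj f g \in [:: -1; 0; 1].
Proof.
case: (eqVneq f g) => [->|neq_fg]; first by rewrite line_adj_diag.
rewrite line_adjE (negPf neq_fg) /D.
have tf := tail_neq_head f; have tg := tail_neq_head g.
have {neq_fg}: ~~ ((head o f \in val g) && (tail o f \in val g)).
  apply: contra neq_fg => /andP[hg tg']; apply/eqP/val_inj/eqP.
  rewrite eqEcard; apply/andP; split; last by rewrite !(orientationP o) !cards2 tf tg.
  by rewrite [val f](orientationP o) subUset !sub1set hg tg'.
rewrite (orientationP o) !inE.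
case: (eqVneq (head o f) (head o g)) => [hfg|_];
case: (eqVneq (head o f) (tail o g)) => [htg|_] //=;
case: (eqVneq (tail o f) (head o g)) => [tfg|_] //=;
case: (eqVneq (tail o f) (tail o g)) => [ttg|_] //=;
by move: tf tg; rewrite -?hfg -?htg -?tfg -?ttg ?hfg ?htg ?tfg ?ttg ?eqxx.
Qed.

Definition antisym_line_graph : signed_graph (edge G) :=
  SignedGraph line_adj_sym line_adj_diag line_adj_val.

End AntisymmetricLineGraph.

Lemma orientation_exists (V : finType) (G : simple_graph V) :
  inhabited (orientation G).
Proof.
have ex (f : edge G) : exists p : V * V, val f == [set p.1; p.2].
  by have /imsetP[p _ ->] := valP f; exists p.
exact: inhabits (Orientation (fun f => eqP (xchooseP (ex f)))).
Qed.

(* Main.v *)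
(** A balanced signed graph switches to an all-positive one (Harary), so
    deleting F makes A(G) balanced only if, after reorienting some edges of G,
    every pair of edges whose concatenation is a directed walk belongs to F.
    Let A be the set of vertices of positive in-degree in that orientation.  An
    edge g not cut by A has its tail in A, hence is preceded by some edge e, and
    g |-> {e, g} is an injection of the uncut edges into F. *)
Require Import Defs.
From mathcomp Require Import all_boot all_order all_algebra.
From mathcomp Require Import ring.
Set Implicit Arguments.
Unset Strict Implicit.
Unset Printing Implicit Defensive.
Import Order.TTheory GRing.Theory Num.Theory.
Local Open Scope ring_scope.

(** * Harary's theorem: a balanced signed graph has a switching potential *)

Section Balance.
Variables (T : finType) (S : signed_graph T).

Lemma sadj_sqr x y : sadj S x y != 0 -> sadj S x y * sadj S x y = 1.
Proof. by have := sadj_val S x y; rewrite !inE => /or3P[] /eqP ->. Qed.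

Lemma prod_next (R : comPzRingType) (t : T -> R) (c : seq T) :
  uniq c -> \prod_(u <- c) t (next c u) = \prod_(u <- c) t u.
Proof.
move=> uc; rewrite -(big_map (next c) xpredT t); apply: perm_big.
have inj : injective (next c) by apply: can_inj (prev_next uc).
apply: uniq_perm => //; first by rewrite map_inj_uniq.
move=> v; apply/mapP/idP => [[u uc' ->]|vc]; first by rewrite mem_next.
by exists (prev c v); rewrite ?mem_prev // next_prev.
Qed.

(** Around the whole cycle each [t u] occurs twice, so the products [t u * t (next c u)] multiply to
    1. The edges other than the one leaving [z] therefore contribute [t z * t (next c z)]. *)
Lemma cycle_sign_potential (t : T -> int) (c : seq T) (z : T) :
    uniq c -> z \in c -> (forall u, t u * t u = 1) ->
    {in c, forall u, u != z -> sadj S u (next c u) = t u * t (next c u)} ->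
  cycle_sign S c = sadj S z (next c z) * (t z * t (next c z)).
Proof.
move=> uc zc t2 tE; rewrite /cycle_sign (bigD1_seq z) //=; congr (_ * _).
have tot : \prod_(u <- c) (t u * t (next c u)) = 1.
  by rewrite big_split /= prod_next // -big_split big1 // => u _; apply: t2.
have {tot} : t z * t (next c z) *
    \prod_(u <- c | u != z) (t u * t (next c u)) = 1.
  by rewrite -(bigD1_seq z) //= tot.
have -> : \prod_(u <- c | u != z) sadj S u (next c u) =
          \prod_(u <- c | u != z) (t u * t (next c u)).
  rewrite big_seq_cond [RHS]big_seq_cond.
  by apply: eq_bigr => u /andP[ucz uz]; apply: tE.
move=> /(congr1 ( *%R (t z * t (next c z)))).
by rewrite mulrA mulrACA !t2 !mul1r mulr1.
Qed.

(** Switching at the vertices where [s] is -1 makes every edge inside [l] positive. *)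
Definition potential_on (l : seq T) (s : T -> int) :=
  (forall u, s u * s u = 1) /\
  {in l &, forall u v, sadj S u v != 0 -> sadj S u v = s u * s v}.

Definition induced (l : seq T) : rel T :=
  [rel u v | [&& u \in l, v \in l & sadj S u v != 0]].

Lemma induced_connect_sym l : connect_sym (induced l).
Proof.
by apply: sym_connect_sym => u v; rewrite /induced /= sadj_sym andbCA.
Qed.

(** A simple path from [y] to [z] inside [l] closes up through [x] to a cycle. Its sign is 1, and
    the potential accounts for all its edges but the two at [x]. *)
Lemma balanced_connected_neighbors l s x y z :
    balanced S -> potential_on l s -> x \notin l -> y \in l ->
    sadj S x y != 0 -> sadj S x z != 0 -> connect (induced l) y z ->
  sadj S x y * s y = sadj S x z * s z.
Proof.
move=> /balancedP bS [s2 sE] xl yl xy xz /connectP[p0 p0P zE].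
rewrite {}zE in xz *; case/shortenP: p0P xz => p pP up _ xz.
(* An empty path means that [y] and [z] coincide; otherwise the cycle has the three vertices that
   [is_cycle] requires. *)
case: p => [//|w p] in pP up xz *.
set q := w :: p in pP up xz *; set z' := last y q in xz *.
have yql : {subset y :: q <= l}.
  move=> u; rewrite inE => /predU1P[-> //|uq].
  have : all [in l] q.
    elim: (q) (y) pP => //= a r IH b /andP[/and3P[_ al _] /IH ->].
    by rewrite al.
  by move/allP/(_ u uq).
have xq : x \notin y :: q by apply: contra xl => /yql.
have ucyc : uniq [:: x, y & q] by rewrite cons_uniq xq up.
have pS : path [rel u v | sadj S u v != 0] y q.
  by apply: sub_path pP => u v /and3P[].
have cyc : is_cycle S [:: x, y & q].
  rewrite /is_cycle ucyc /= xy rcons_path /= -/q.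
  by move: pS => /= /andP[-> ->]; rewrite sadj_sym.
set c := [:: x, y & q] in ucyc cyc.
have cy : cycle [rel u v | sadj S u v != 0] c by case/and3P: cyc.
have zyq : z' \in y :: q by apply: mem_last.
have zx : z' != x by apply: contraNneq xq => <-.
have nz : next c z' = x.
  have -> : z' = prev c x.
    have prev_last r b : x \notin b :: r -> prev_at x x b r = last b r.
      elim: r b => [|d r IH] b /=; first by rewrite eqxx.
      by rewrite inE => /norP[_ dr]; rewrite IH //; case: eqP dr => // ->;
        rewrite mem_head.
    rewrite /z' -(prev_last q y xq) /c /prev.
    by move: xq; rewrite inE => /norP[/negPf xy' _]; rewrite [RHS]/= xy'.
  exact: next_prev.
have nx : next c x = y by rewrite /c /= eqxx.
(* The potential t accounts for every edge of c except the closing one, from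
   z' to x, so the sign of c is the discrepancy there. *)
pose t u := if u == x then sadj S x y * s y else s u.
have t2 u : t u * t u = 1.
  by rewrite /t; case: eqP => // _; rewrite mulrACA sadj_sqr // s2 mulr1.
have := bS _ cyc; rewrite (@cycle_sign_potential t _ z') //.
- rewrite nz /t eqxx (negPf zx) sadj_sym => E.
  have := congr1 (fun a => sadj S x z' * s z' * a) E.
  rewrite mulr1 => <-.
  have -> : sadj S x z' * s z' * (sadj S x z' * (s z' * (sadj S x y * s y))) =
    (sadj S x z' * sadj S x z') * (s z' * s z') * (sadj S x y * s y) by ring.
  by rewrite sadj_sqr // s2 !mul1r.
- by rewrite inE zyq orbT.
move=> u uc uz; have [->|ux] := eqVneq u x.
  rewrite nx /t eqxx; case: eqP => [yx|_].
    by move: xq; rewrite -yx mem_head.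
  by rewrite -mulrA s2 mulr1.
have nux : next c u != x.
  by apply: contraNneq uz => nu; rewrite -(prev_next ucyc u) nu -nz prev_next.
rewrite /t (negPf ux) (negPf nux); apply: sE.
- by apply: yql; move: uc; rewrite /c in_cons (negPf ux).
- by apply: yql; have := mem_next c u; rewrite uc {2}/c in_cons (negPf nux).
- exact: (next_cycle cy uc).
Qed.

(* To extend s to a new vertex x, switch each component of l adjacent to x so
   that one edge, hence every edge, from x to that component is positive. *)
Lemma balanced_potential_on l : balanced S -> exists s, potential_on l s.
Proof.
move=> bS; elim: l => [|x l [s sP]]; first by exists (fun=> 1).
have [xl|xl] := boolP (x \in l).
  exists s; case: sP => s2 sE; split=> // u v.
  by rewrite !inE => /predU1P[->|ul] /predU1P[->|vl]; apply: sE.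
have [s2 sE] := sP.
pose P v y := [&& connect (induced l) v y, y \in l & sadj S x y != 0].
(* [k] is the switching factor of the component of [v]; components without a neighbor of [x] keep
   the factor 1. *)
pose k v := if [pick y | P v y] is Some y then sadj S x y * s y else 1.
have k2 v : k v * k v = 1.
  rewrite /k; case: pickP => [y /and3P[_ _ xy]|//].
  by rewrite mulrACA sadj_sqr // s2 mulr1.
have kx v : v \in l -> sadj S x v != 0 -> sadj S x v = k v * s v.
  move=> vl xv; rewrite /k; case: pickP => [y /and3P[vy yl xy]|/(_ v)].
    rewrite -(balanced_connected_neighbors bS sP xl vl xv xy vy).
    by rewrite -mulrA s2 mulr1.
  by rewrite /P connect0 vl xv.
(* Adjacent vertices share a component, so [P u] and [P v] agree and [pick] returns the same
   neighbor of [x]. *)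
have kE u v : u \in l -> v \in l -> sadj S u v != 0 -> k u = k v.
  move=> ul vl uv; rewrite /k (@eq_pick _ _ (P v)) // => y; rewrite /P.
  have uv' : connect (induced l) u v.
    by apply: connect1; rewrite /induced /= ul vl.
  by rewrite (same_connect (@induced_connect_sym l) uv').
exists (fun v => if v == x then 1 else k v * s v); split=> [u|u v].
  by case: eqP => // _; rewrite mulrACA k2 s2.
rewrite !inE; have [->|ux] /= := eqVneq u x; have [->|vx] /= := eqVneq v x.
- by rewrite sadj_diag eqxx.
- by move=> _ vl xv; rewrite mul1r kx.
- by move=> ul _; rewrite sadj_sym mulr1; apply: kx.
move=> ul vl uv; rewrite (kE u v) // mulrACA k2 mul1r.
exact: sE.
Qed.

Theorem balanced_potential : balanced S ->
  exists s : T -> int, (forall u, s u * s u = 1) /\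
    (forall u v, sadj S u v != 0 -> sadj S u v = s u * s v).
Proof.
move=> /(balanced_potential_on (enum T))[s [s2 sE]]; exists s; split=> // u v.
by apply: sE; rewrite mem_enum.
Qed.

End Balance.

(** * Reorienting by a potential, and the cut given by the heads *)

Section Reorientation.
Variables (V : finType) (G : simple_graph V) (o : orientation G).
Variable s : edge G -> int.
Hypothesis s2 : forall e, s e * s e = 1.

Definition rhead e := if s e == 1 then Defs.head o e else tail o e.
Definition rtail e := if s e == 1 then tail o e else Defs.head o e.

Lemma val_edgeE e : val e = [set rtail e; rhead e].
Proof.
by rewrite (orientationP o) /rtail /rhead; case: ifP => // _; rewrite setUC.
Qed.

Lemma rtail_neq_rhead e : rtail e != rhead e.
Proof.
by rewrite /rtail /rhead; case: ifP => _; rewrite ?tail_neq_head // eq_sym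
  tail_neq_head.
Qed.

Lemma rhead_rtail_neq e g : rhead e = rtail g -> e != g.
Proof.
by move=> eg; apply: contra_neq (rtail_neq_rhead g) => E; rewrite -eg E.
Qed.

(** Two opposite edges would have the same endpoints, hence be the same edge of a simple graph. *)
Lemma no_2cycle e g : rhead e = rtail g -> rhead g != rtail e.
Proof.
move=> eg; apply: contra_neq (rhead_rtail_neq eg) => ge; apply: val_inj.
by rewrite !val_edgeE eg ge setUC.
Qed.

(** Reorienting by [s] switches the line graph by [s]. In the new orientation the only common vertex
    is the head of [e] and the tail of [g], which gives the entry -1. *)
Lemma line_adj_rhead_rtail e g :
  rhead e = rtail g -> line_adj o e g = - (s e * s g).
Proof.
move=> eg; have sE f : s f = if s f == 1 then 1 else -1.
  have : (s f == 1) || (s f == -1) by rewrite -sqrf_eq1 expr2 s2.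
  by case: eqP => //= _ /eqP.
have := no_2cycle eg; have := rtail_neq_rhead e; have := rtail_neq_rhead g.
rewrite line_adjE (negPf (rhead_rtail_neq eg)) (sE e) (sE g).
move: eg; rewrite /rhead /rtail.
case: ifP => _; case: ifP => _ -> /negPf gg /negPf ee /negPf ge;
  rewrite ?eqxx ?ee ?gg ?ge ?[_ == Defs.head o g]eq_sym ?[_ == tail o g]eq_sym;
  by rewrite ?eqxx ?ee ?gg ?ge // eq_sym ?ee ?gg ?ge.
Qed.

Lemma maxcut_defect_le (F : {set {set edge G}}) :
    (forall e g, rhead e = rtail g -> [set e; g] \in F) ->
  (maxcut_defect G <= #|F|)%N.
Proof.
move=> FP; pose A := [set v | [exists e, rhead e == v]].
pose N := [set g | rtail g \in A].
pose p g := odflt g [pick e | rhead e == rtail g].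
have pP g : g \in N -> rhead (p g) = rtail g.
  rewrite !inE => /existsP[e eg]; rewrite /p; case: pickP => [? /eqP //|].
  by move/(_ e); rewrite eg.
(* If distinct [g] and [h] gave the same pair, each would precede the other, a directed 2-cycle. *)
have inj : {in N &, injective (fun g => [set p g; g])}.
  move=> g h gN hN /setP E; apply/eqP; apply: contraT => gh.
  have := E h; have := E g; rewrite !inE !eqxx !orbT (negPf gh) orbF.
  rewrite [h == g]eq_sym (negPf gh) orbF => /esym/eqP gph /eqP hpg.
  by have := no_2cycle (pP _ gN); rewrite -hpg -(pP _ hN) -gph eqxx.
apply: (@leq_trans #|N|); last first.
  rewrite -(card_in_imset inj); apply/subset_leq_card/subsetP => f.
  by move=> /imsetP[g gN ->]; apply/FP/pP.
have cutE : cut_edges G A \subset edges G by apply/subsetP => f /setIdP[].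
apply: (@leq_trans #|edges G :\: cut_edges G A|).
  rewrite cardsD (setIidPr cutE); apply: leq_sub2l.
  exact: (@leq_bigmax _ (fun B => #|cut_edges G B|) A).
rewrite -(card_imset (mem N) val_inj); apply/subset_leq_card/subsetP => f.
rewrite inE => /andP[ncut fG]; apply/imsetP.
exists (Sub f fG : edge G) => //; rewrite inE; apply: contraNT ncut => tA.
set g : edge G := Sub f fG in tA; have fE : f = val g by [].
(* Every head lies in [A], so an edge whose tail is outside [A] is cut. *)
have hA : rhead g \in A by rewrite inE; apply/existsP; exists g.
rewrite inE fG fE val_edgeE /=; apply/andP; split; apply/set0Pn.
  by exists (rhead g); rewrite in_setI set22.
by exists (rtail g); rewrite in_setI set21 in_setC.
Qed.

End Reorientation.

Theorem theorem6 (V : finType) (G : simple_graph V) (o : orientation G) :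
  (maxcut_defect G <= frustration (antisym_line_graph o))%N.
Proof.
rewrite /frustration; case: ex_minnP => _ /existsP[F /and3P[_ bF /eqP <-]] _.
have [s [s2 sE]] := balanced_potential bF.
apply: (@maxcut_defect_le _ _ o s) => e g eg; apply: contraT => egF.
(* If the pair survived the deletion, its sign would be both [s e * s g] and its opposite, although
   this product is nonzero. *)
have := sE e g; rewrite /= /delete_adj (negPf egF) /=.
rewrite (line_adj_rhead_rtail s2 eg).
have : s e * s g * (s e * s g) = 1 by rewrite mulrACA !s2.
have [->|nz _] := eqVneq (s e * s g) 0; first by rewrite mul0r.
rewrite oppr_eq0 => /(_ nz)/eqP.
by rewrite eq_sym -addr_eq0 -mulr2n mulrn_eq0 (negPf nz).
Qed.
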